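(* Let $s$ be a Koebe polyhedron and let $m$ be a discrete s-isothermic minimal surface, i.e. the Christoffel dual of $s$. Then $m$ has vanishing mean curvature with respect to the Gauss image $s$, and every face $f$ has principal curvatures $\kappa_{1,f}$ and $\kappa_{2,f}=-\kappa_{1,f}$.
   Context: Mesh combinatorics: a 2-dimensional cell complex $(V,E,F)$; a mesh is a map $i\in V\mapsto m_i\in\mathbb{R}^3$, and for a face $f=(i_1,\dots,i_n)$, $m(f)=(m_{i_1},\dots,m_{i_n})$. A polyhedral surface is a mesh whose faces are planar. A Koebe polyhedron $s$ is a polyhedral surface with strictly convex faces which is midscribed to the unit sphere $S^2$: every edge $s_is_j$ touches $S^2$ in an interior point $q_{ij}$ of the edge. Consequently each face has an incircle, touching its edges in the points $q_{ij}$. Christoffel duality for Koebe polyhedra (s-isothermic duality): all faces are assumed to have an even number of edges (if faces with an odd number of edges occur one passes to a branched double covering, where the corresponding face polygon runs twice around its boundary). The edges carry signs $\varepsilon_{ij}=\varepsilon_{ji}\in\{1,-1\}$ such that any two consecutive edges of any face carry opposite signs. A dual of $s$ is a mesh $m$ of the same combinatorics such that, up to a common nonzero factor, for every edge $$m_j-m_i=\varepsilon_{ij}\left(\frac{s_j-q_{ij}}{\|s_j-q_{ij}\|^2}-\frac{s_i-q_{ij}}{\|s_i-q_{ij}\|^2}\right).$$ (In complex notation in the plane of a face, each vector $w$ from a touching point to an adjacent vertex is replaced by $\pm1/\overline{w}$.) Then $m$ is a polyhedral surface parallel to $s$, called a discrete s-isothermic minimal surface. For parallel polyhedral surfaces the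 polygons $m(f)$ and $s(f)$ lie in parallel planes. There, $A(P)=\frac12\sum_i\det(p_i,p_{i+1})$ (indices cyclic) is the oriented area and $A(P,Q)$ the associated symmetric bilinear form. The mean and Gaussian curvatures of the face $f$ of $m$ with respect to the Gauss image $s$ are $H_f=-A(m(f),s(f))/A(m(f))$ and $K_f=A(s(f))/A(m(f))$, and the principal curvatures are the (real) zeros $\kappa_{1,f},\kappa_{2,f}$ of $x^2-2H_fx+K_f$. *)

(* Defs.v *)
From HB Require Import structures.
From mathcomp Require Import all_boot all_order all_algebra.
From mathcomp Require Import reals.

Set Implicit Arguments.
Unset Strict Implicit.
Unset Printing Implicit Defensive.

Import Order.TTheory GRing.Theory Num.Theory.
Local Open Scope ring_scope.

(* Cyclic indices are elements of 'I_n; [ordS] is the cyclic successor.       *)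

(* Edges are pairs of vertices, as in the notation "edge ij".  Neither        *)
(* finiteness nor a manifold condition is imposed.                            *)
Record complex := Complex {
  vert : Type;
  edge : vert -> vert -> Prop;
  face : Type;
  deg : face -> nat;
  bd : forall f : face, 'I_(deg f) -> vert;
  edge_sym : forall i j, edge i j -> edge j i;
  edge_irr : forall i, ~ edge i i;
  deg_ge3 : forall f, (3 <= deg f)%N;
  bd_inj : forall f, injective (@bd f);
  bd_edge : forall f (k : 'I_(deg f)), edge (bd k) (bd (ordS k)) }.

(* [even_cover C' C] is a covering of C with one or two sheets, unbranched    *)
(* over the even faces of C and doubly branched over the odd ones; the        *)
(* boundary of a face of C' runs once around an even face of C and twice      *)
(* around an odd one.  If all faces of C are even, C itself is such a         *)
(* covering (see [trivial_cover]); otherwise C' is the branched double cover. *)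
Record even_cover (C' C : complex) := EvenCover {
  cvert : vert C' -> vert C;
  cface : face C' -> face C;
  cwrap : forall f : face C', 'I_(deg f) -> 'I_(deg (cface f));
  cover_fibre : forall i, exists x y, forall z, cvert z = i <-> z = x \/ z = y;
  cover_edge : forall x y, edge x y -> edge (cvert x) (cvert y);
  cover_edge_lift : forall x j, edge (cvert x) j ->
    exists! y, edge x y /\ cvert y = j;
  cover_deg : forall f : face C', deg f =
    if odd (deg (cface f)) then (deg (cface f)).*2 else deg (cface f);
  cover_wrap : forall (f : face C') k, cwrap (ordS k) = ordS (@cwrap f k);
  cover_bd : forall (f : face C') k, cvert (bd k) = bd (@cwrap f k);
  cover_face_lift : forall (f : face C) (k : 'I_(deg f)) x, cvert x = bd k ->
    exists f' : face C', cface f' = f /\ exists k' : 'I_(deg f'), bd k' = x }.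

Definition trivial_cover (C : complex) :
  (forall f : face C, ~~ odd (deg f)) -> even_cover C C.
Proof.
move=> even_deg.
exists id id (fun _ => id) => //.
- by move=> i; exists i, i => z; split=> [->|[]//]; left.
- by move=> x j xj; exists j; split=> // y [].
- by move=> f; rewrite (negbTE (even_deg f)).
- by move=> f k x ->; exists f; split=> //; exists k.
Defined.

Section Geometry.
Variable R : realType.

Notation vec := 'rV[R]_3.

Definition dot (u v : vec) : R := (u *m v^T) 0 0.

Definition det3 (u v w : vec) : R :=
  \det (\matrix_(i < 3) tnth [tuple u; v; w] i).

(* w / |w|^2 for the Euclidean norm *)
Definition inversion (w : vec) : vec := (dot w w)^-1 *: w.

Definition unit_normal n (nu : vec) (P : 'I_n -> vec) :=
  dot nu nu = 1 /\ forall k l, dot nu (P k - P l) = 0.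

Definition planar n (P : 'I_n -> vec) := exists nu, unit_normal nu P.

(* With respect to one of the two orientations of its plane, every edge has   *)
(* all the other vertices strictly on its left.                               *)
Definition strictly_convex n (P : 'I_n -> vec) :=
  exists nu, unit_normal nu P /\
    forall i k, k <> i -> k <> ordS i ->
      0 < det3 (P (ordS i) - P i) (P k - P i) nu.

(* For a unit vector nu, det3 u v nu is the determinant of the orthogonal     *)
(* projections of u and v to the plane nu^\perp, oriented by nu.              *)
Definition area n (nu : vec) (P : 'I_n -> vec) : R :=
  2^-1 * \sum_(k < n) det3 (P k) (P (ordS k)) nu.

Definition mixed_area n (nu : vec) (P Q : 'I_n -> vec) : R :=
  2^-1 * (area nu (fun k => P k + Q k) - area nu P - area nu Q).

(* The segment ab is tangent to the unit sphere at its interior point q.      *)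
Definition touches (a b q : vec) :=
  [/\ a <> b,
      exists t : R, 0 < t < 1 /\ q = (1 - t) *: a + t *: b,
      dot q q = 1 &
      dot q (b - a) = 0].

Definition mesh (C : complex) := vert C -> vec.

Definition polygon (C : complex) (m : mesh C) (f : face C) : 'I_(deg f) -> vec :=
  fun k => m (bd k).
#[local] Arguments polygon {C} m f _.

Definition polyhedral (C : complex) (m : mesh C) :=
  forall f, planar (polygon m f).

Definition parallel (C : complex) (m s : mesh C) :=
  forall i j, edge i j -> exists a b : R, (a != 0) || (b != 0) /\
    a *: (m j - m i) = b *: (s j - s i).

Definition koebe (C : complex) (s : mesh C) :=
  [/\ polyhedral s,
      forall f, strictly_convex (polygon s f) &
      forall i j, edge i j -> exists q, touches (s i) (s j) q].

Definition pullback (C' C : complex) (p : even_cover C' C) (s : mesh C) :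
  mesh C' := fun x => s (cvert p x).

(* The touching point q of an edge is determined by the end points: it is the *)
(* point of the edge closest to the origin.                                   *)
Definition christoffel_dual (C : complex) (s m : mesh C) :=
  exists (c : R) (eps : vert C -> vert C -> R),
  [/\ c != 0,
      forall i j, edge i j -> eps i j = eps j i /\ (eps i j = 1 \/ eps i j = -1),
      forall (f : face C) (k : 'I_(deg f)),
        eps (bd (ordS k)) (bd (ordS (ordS k))) = - eps (bd k) (bd (ordS k)) &
      forall i j q, edge i j -> touches (s i) (s j) q ->
        m j - m i = (c * eps i j) *: (inversion (s j - q) - inversion (s i - q))].

(* In the following nu is a unit normal of the parallel planes of m(f) and    *)
(* s(f).  Replacing nu by -nu changes the sign of all areas, hence does not   *)
(* affect the curvatures.  They are meaningful if area nu (polygon m f) != 0. *)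

Definition mean_curvature (C : complex) (m s : mesh C) (f : face C) (nu : vec)
    : R :=
  - mixed_area nu (polygon m f) (polygon s f) / area nu (polygon m f).

Definition gauss_curvature (C : complex) (m s : mesh C) (f : face C) (nu : vec)
    : R :=
  area nu (polygon s f) / area nu (polygon m f).

(* k1 and k2 are the zeros, with multiplicity, of x^2 - 2 H x + K.            *)
Definition principal_curvatures (C : complex) (m s : mesh C) (f : face C)
    (nu : vec) (k1 k2 : R) :=
  'X^2 - (2 * mean_curvature m s f nu) *: 'X + (gauss_curvature m s f nu)%:P
  = ('X - k1%:P) * ('X - k2%:P).

End Geometry.

Arguments polygon {R C} m f _.

(* Main.v *)
Require Import Defs.
From HB Require Import structures.
From mathcomp Require Import all_boot all_order all_algebra.
From mathcomp Require Import reals.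
From mathcomp Require Import ring lra.

Set Implicit Arguments.
Unset Strict Implicit.
Unset Printing Implicit Defensive.

Import Order.TTheory GRing.Theory Num.Theory.
Local Open Scope ring_scope.

(** Fix a face, a unit normal nu of its plane, and let J be the quarter turn
    [perp nu] of that plane.  The sphere cuts the plane in the incircle of the
    face polygon P, with center z.  Write e_k for the unit direction of the
    edge P_k P_{k+1} and l_k for the length of the two tangents from P_k.
    Since the radius of the circle to the touching point of an edge is
    orthogonal to it, this point is z - rho J e_k, where rho is the radius up
    to sign.  The sign is the same for all edges, because consecutive edges
    are not folded back onto each other ([incircle_step]); it compares nu with
    the orientation of the polygon.

    The defining equation of the dual m reads
      m_{k+1} - m_k = delta_k (1/l_k + 1/l_{k+1}) e_k
    with delta_k = +-c alternating ([inversion_edge]), which gives planarity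
    and parallelism.  For polygons with parallel edges the mixed area is half
    the sum of the products of the support numbers of one with the signed
    edge lengths of the other ([mixed_areaE]).  With respect to z, all support
    numbers of P equal rho, so that
      A(P) = rho sum_k l_k   and
      A(m, P) = rho/2 sum_k delta_k (1/l_k + 1/l_{k+1}) = 0,
    the last sum being telescopic: H = 0.

    It remains to see that A(m) is nonzero and of the sign opposite to A(P),
    for then the zeros of x^2 + K are real and opposite.  The edge lines of m
    are tangent to a circle, too, with support numbers of alternating signs:
    the point
      O = m_k + delta_k (e_k / l_k - J e_k / rho)
    does not depend on k, and the support numbers of m with respect to O are
    - delta_k / rho.  Hence ([area_dual])
      A(m) = - 1/rho sum_k delta_k^2 / l_k.
    All three areas are sums of local contributions of the edges, so the same
    formulas hold for a polygon that runs twice around an odd face. *)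

(** * The quarter turn of a plane in Euclidean 3-space *)

Section Euclidean.
Variable R : realType.
Notation vec := 'rV[R]_3.
Implicit Types (u v w nu : vec) (a : R).

Lemma dotE u v : dot u v = u 0 0 * v 0 0 + u 0 1 * v 0 1 + u 0 2 * v 0 2.
Proof.
rewrite /dot mxE !big_ord_recl big_ord0 !mxE addr0 !addrA.
by congr (_ * _ + _ * _ + _ * _); congr (_ _ _); apply/val_inj.
Qed.

Lemma row3P u v :
  u 0 0 = v 0 0 -> u 0 1 = v 0 1 -> u 0 2 = v 0 2 -> u = v.
Proof.
move=> e0 e1 e2; apply/rowP=> -[[|[|[|//]]] lt_j3].
- by rewrite (_ : Ordinal _ = 0) //; apply/val_inj.
- by rewrite (_ : Ordinal _ = 1) //; apply/val_inj.
- by rewrite (_ : Ordinal _ = 2) //; apply/val_inj.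
Qed.

Lemma dotC u v : dot u v = dot v u.
Proof. by rewrite !dotE; ring. Qed.

Lemma dotDl u v w : dot (u + v) w = dot u w + dot v w.
Proof. by rewrite /dot mulmxDl mxE. Qed.

Lemma dotZl a u v : dot (a *: u) v = a * dot u v.
Proof. by rewrite /dot -scalemxAl mxE. Qed.

Lemma dotNl u v : dot (- u) v = - dot u v.
Proof. by rewrite -scaleN1r dotZl mulN1r. Qed.

Lemma dotDr u v w : dot u (v + w) = dot u v + dot u w.
Proof. by rewrite dotC dotDl !(dotC u). Qed.

Lemma dotZr a u v : dot u (a *: v) = a * dot u v.
Proof. by rewrite dotC dotZl dotC. Qed.

Lemma dotNr u v : dot u (- v) = - dot u v.
Proof. by rewrite dotC dotNl dotC. Qed.

Lemma dot0r u : dot u 0 = 0.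
Proof. by rewrite -(scale0r 0) dotZr mul0r. Qed.

Definition dot_lin := (dotDl, dotDr, dotNl, dotNr, dotZl, dotZr).

Lemma dot_ge0 u : 0 <= dot u u.
Proof. by rewrite dotE -!expr2 !addr_ge0 ?sqr_ge0. Qed.

Lemma dot_eq0 u : (dot u u == 0) = (u == 0).
Proof.
apply/eqP/eqP=> [|->]; last exact: dot0r.
rewrite dotE -!expr2 => /eqP.
rewrite !paddr_eq0 ?addr_ge0 ?sqr_ge0 // !sqrf_eq0.
by case/andP=> /andP[/eqP u0 /eqP u1] /eqP u2; apply: row3P; rewrite mxE.
Qed.

(** The cross product of nu and v; for a unit vector nu it restricts to a
    quarter turn of the plane orthogonal to nu. *)
Definition perp nu v : vec :=
  \row_j tnth [tuple nu 0 1 * v 0 2 - nu 0 2 * v 0 1;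
                     nu 0 2 * v 0 0 - nu 0 0 * v 0 2;
                     nu 0 0 * v 0 1 - nu 0 1 * v 0 0] j.

Lemma perpE nu v :
  (perp nu v 0 0 = nu 0 1 * v 0 2 - nu 0 2 * v 0 1) *
  (perp nu v 0 1 = nu 0 2 * v 0 0 - nu 0 0 * v 0 2) *
  (perp nu v 0 2 = nu 0 0 * v 0 1 - nu 0 1 * v 0 0).
Proof. by rewrite !mxE. Qed.

Lemma perpD nu u v : perp nu (u + v) = perp nu u + perp nu v.
Proof. by apply: row3P; rewrite [RHS]mxE !perpE !mxE; ring. Qed.

Lemma perpZ nu a v : perp nu (a *: v) = a *: perp nu v.
Proof. by apply: row3P; rewrite [RHS]mxE !perpE !mxE; ring. Qed.

Lemma perpN nu v : perp nu (- v) = - perp nu v.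
Proof. by rewrite -scaleN1r perpZ scaleN1r. Qed.

Lemma dot_perp nu u v : dot (perp nu u) v = - dot u (perp nu v).
Proof. by rewrite !dotE !perpE; ring. Qed.

Lemma dot_perp_id nu u : dot (perp nu u) u = 0.
Proof. by rewrite !dotE !perpE; ring. Qed.

Lemma perp_perp nu v : perp nu (perp nu v) = dot nu v *: nu - dot nu nu *: v.
Proof. by apply: row3P; rewrite !perpE !dotE !mxE; ring. Qed.

Lemma perpK nu v : dot nu nu = 1 -> dot nu v = 0 -> perp nu (perp nu v) = - v.
Proof. by move=> nu1 nuv; rewrite perp_perp nu1 nuv scale0r scale1r add0r. Qed.

Lemma det3E u v nu : det3 u v nu = dot (perp nu u) v.
Proof.
rewrite dotE !perpE /det3.
rewrite (expand_det_row _ 0) !big_ord_recl big_ord0 /cofactor.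
rewrite !(expand_det_row _ 0) !big_ord_recl !big_ord0 /cofactor !det_mx11.
rewrite !mxE /= !(tnth_nth 0) /=.
(* Comparing the column indices as natural numbers lets the entries of one
   vector be recognized as equal. *)
have [f fE] : exists f : vec -> nat -> R, forall w i, w 0 i = f w (val i).
  by exists (fun w k => w 0 (inord k)) => w i; rewrite inord_val.
by rewrite !fE /=; ring.
Qed.

(** The Gram determinant of u, v and nu is the square of their
    determinant. *)
Lemma dot_perp_sqr u v nu : dot nu u = 0 -> dot nu v = 0 -> dot u v = 0 ->
  dot u (perp nu v) ^+ 2 = dot u u * dot v v * dot nu nu.
Proof.
move=> nuu nuv uv.
suff: dot u (perp nu v) ^+ 2 = dot u u * dot v v * dot nu nu
      + 2 * dot u v * dot nu u * dot nu v - dot u u * dot nu v ^+ 2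
      - dot v v * dot nu u ^+ 2 - dot nu nu * dot u v ^+ 2.
  by rewrite nuu nuv uv => ->; ring.
by rewrite !dotE !perpE; ring.
Qed.

Lemma orthogonal_in_plane nu e v :
  dot nu nu = 1 -> dot nu e = 0 -> dot nu v = 0 -> dot e e = 1 ->
  dot v e = 0 -> v = dot v (perp nu e) *: perp nu e.
Proof.
move=> nu1 nue nuv e1 ve; apply/eqP; rewrite -subr_eq0 -dot_eq0; apply/eqP.
have Je1 : dot (perp nu e) (perp nu e) = 1.
  by rewrite dot_perp perpK // dotNr opprK.
have := dot_perp_sqr nuv nue ve; rewrite nu1 e1 !mulr1 => vJe.
by rewrite !dot_lin Je1 (dotC _ v) -vJe; ring.
Qed.
End Euclidean.

(** * Oriented and mixed area of closed polygons *)

Section CyclicIndices.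
Variable n : nat.

Lemma ordS_constant T (f : 'I_n -> T) :
  (forall k, f (ordS k) = f k) -> forall k l, f k = f l.
Proof.
move=> fS k l; wlog le_kl : k l / (k <= l)%N.
  by move=> H; case/orP: (leq_total k l) => [/H //|/H ->].
have step j (lt_jn : (k + j < n)%N) : f (Ordinal lt_jn) = f k.
  elim: j lt_jn => [|j IHj] lt_jn; first by congr f; apply/val_inj/addn0.
  have lt_jn' : (k + j < n)%N by rewrite -ltnS -addnS ltnW.
  rewrite -(IHj lt_jn') -[RHS]fS; congr f; apply/val_inj => /=.
  by rewrite addnS modn_small // -addnS.
have lt_ln : (k + (l - k) < n)%N by rewrite subnKC.
by rewrite -(step _ lt_ln); congr f; apply/val_inj; rewrite /= subnKC.
Qed.

Lemma sum_ordS (V : nmodType) (f : 'I_n -> V) :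
  \sum_(k < n) f (ordS k) = \sum_(k < n) f k.
Proof. by rewrite [RHS](reindex_inj (@ordS_inj n)). Qed.

End CyclicIndices.

Section Area.
Variables (R : realType) (n : nat) (nu : 'rV[R]_3).
Implicit Types P Q : 'I_n -> 'rV[R]_3.

Lemma eq_area P Q : P =1 Q -> area nu P = area nu Q.
Proof. by move=> PQ; congr (_ * _); apply: eq_bigr => k _; rewrite !PQ. Qed.

Lemma mixed_area_diag P : mixed_area nu P P = area nu P.
Proof.
rewrite /mixed_area /area.
suff -> : \sum_(k < n) det3 (P k + P k) (P (ordS k) + P (ordS k)) nu =
          4 * \sum_(k < n) det3 (P k) (P (ordS k)) nu by field.
rewrite mulr_sumr; apply: eq_bigr => k _; rewrite !det3E perpD !dot_lin; ring.
Qed.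

(** Summation by parts: the two halves of the polarized area differ by a
    telescopic sum and by the determinants of corresponding edges, which
    vanish for parallel edges.  As Q is closed, the origin from which P is
    seen may be moved to any point o. *)
Lemma mixed_areaE o P Q :
  (forall k, det3 (P (ordS k) - P k) (Q (ordS k) - Q k) nu = 0) ->
  mixed_area nu P Q =
  2^-1 * \sum_(k < n) det3 (P k - o) (Q (ordS k) - Q k) nu.
Proof.
move=> PQ; rewrite /mixed_area /area -!mulrBr mulrA.
rewrite -!sumrB.
have Q0 : \sum_(k < n) det3 o (Q (ordS k) - Q k) nu = 0.
  transitivity (\sum_(k < n) (det3 o (Q (ordS k)) nu - det3 o (Q k) nu)).
    by apply: eq_bigr => k _; rewrite !det3E !dot_lin.
  by rewrite sumrB (sum_ordS (fun k => det3 o (Q k) nu)) subrr.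
have PQ0 : \sum_(k < n) (det3 (P (ordS k)) (Q (ordS k)) nu
                        - det3 (P k) (Q k) nu) = 0.
  by rewrite sumrB (sum_ordS (fun k => det3 (P k) (Q k) nu)) subrr.
transitivity (2^-1 / 2 * \sum_(k < n)
    (2 * (det3 (P k - o) (Q (ordS k) - Q k) nu + det3 o (Q (ordS k) - Q k) nu)
     - (det3 (P (ordS k)) (Q (ordS k)) nu - det3 (P k) (Q k) nu))).
  congr (_ * _); apply: eq_bigr => k _; have := PQ k.
  rewrite !det3E !(perpD, perpN) !dot_lin !(dotC (perp nu (Q k))).
  by rewrite !dotE !perpE; lra.
by rewrite sumrB PQ0 -mulr_sumr big_split /= Q0; field.
Qed.
End Area.

(** * Edges touching the unit sphere *)

Section Tangents.
Variable R : realType.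
Notation vec := 'rV[R]_3.
Implicit Types (a b q e v nu z : vec).

(** By Pythagoras, the length of every tangent from a to the unit sphere; as
    it depends on a only, consecutive edges share it. *)
Definition tangent_length a : R := Num.sqrt (dot a a - 1).

(** For an edge ab tangent to the sphere, its length is the sum of the tangent
    lengths of its ends, and this is its unit direction. *)
Definition edge_dir a b : vec :=
  (tangent_length a + tangent_length b)^-1 *: (b - a).

Lemma touches_frame a b q : touches a b q ->
  [/\ 0 < tangent_length a, 0 < tangent_length b,
      dot (edge_dir a b) (edge_dir a b) = 1,
      a = q - tangent_length a *: edge_dir a b &
      b = q + tangent_length b *: edge_dir a b].
Proof.
case=> /eqP ab [t [/andP[t0 t1] qE]] q1 qd.
have [d dE] : exists d, d = b - a by exists (b - a).
rewrite -dE in qd.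
have aE : a = q - t *: d by rewrite qE dE; apply/rowP=> j; rewrite !mxE; ring.
have bE : b = q + (1 - t) *: d.
  by rewrite qE dE; apply/rowP=> j; rewrite !mxE; ring.
have [D D0 dd] : exists2 D : R, 0 < D & dot d d = D ^+ 2.
  exists (Num.sqrt (dot d d)); last by rewrite sqr_sqrtr ?dot_ge0.
  by rewrite sqrtr_gt0 lt0r dot_ge0 dot_eq0 dE subr_eq0 eq_sym ab.
have la : tangent_length a = t * D.
  rewrite -[RHS]ger0_norm ?mulr_ge0 1?ltW // -sqrtr_sqr exprMn -dd.
  by congr (Num.sqrt _); rewrite aE !dot_lin (dotC d) q1 qd; ring.
have lb : tangent_length b = (1 - t) * D.
  rewrite -[RHS]ger0_norm ?mulr_ge0 1?ltW ?subr_gt0 // -sqrtr_sqr exprMn -dd.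
  by congr (Num.sqrt _); rewrite bE !dot_lin (dotC d) q1 qd; ring.
have D_neq0 : D != 0 by rewrite gt_eqF.
have dirE : edge_dir a b = D^-1 *: d.
  by rewrite /edge_dir la lb dE -mulrDl addrC subrK mul1r.
split; rewrite ?la ?lb ?mulr_gt0 ?subr_gt0 // dirE.
- by rewrite !dot_lin dd; field.
- by rewrite scalerA mulfK.
- by rewrite scalerA mulfK.
Qed.

Lemma inversion_scale (x : R) e : dot e e = 1 -> x != 0 ->
  inversion (x *: e) = x^-1 *: e.
Proof.
move=> e1 x0; rewrite /inversion !dot_lin e1 scalerA mulr1; congr (_ *: _).
by field.
Qed.

(** The vectors from q to a and b point in opposite directions, so the
    difference of their inversions adds up the inverse lengths. *)
Lemma inversion_edge a b q : touches a b q ->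
  inversion (b - q) - inversion (a - q) =
  ((tangent_length a)^-1 + (tangent_length b)^-1) *: edge_dir a b.
Proof.
case/touches_frame; move: (tangent_length a) (tangent_length b) (edge_dir a b).
move=> la lb e la0 lb0 e1 -> ->.
rewrite [q + _]addrC addrK [q - _]addrC addrK -(scaleNr la).
rewrite !inversion_scale ?oppr_eq0 ?gt_eqF // -scalerBl invrN opprK.
by rewrite addrC.
Qed.

(** The common end of two consecutive edges with directions e and e' is
    reached, relative to the center, from both touching points; rho and rho'
    are the signed radii.  In complex notation the equation says
    (l - i rho) e = - (l + i rho') e'.  If rho' = - rho, cancelling the nonzero
    factor l - i rho gives e' = - e: the second edge would fold back onto the
    first.  This also excludes rho = 0, i.e. a face tangent to the sphere.
    The last conclusion is J applied to the equation. *)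
Lemma incircle_step (rho rho' l : R) nu e e' :
  dot nu nu = 1 -> dot nu e = 0 -> dot nu e' = 0 -> 0 < l -> e + e' != 0 ->
  rho ^+ 2 = rho' ^+ 2 ->
  l *: e - rho *: perp nu e = - (l *: e') - rho' *: perp nu e' ->
  [/\ rho' = rho, rho != 0 &
      rho *: (e - e') = - (l *: (perp nu e + perp nu e'))].
Proof.
move=> nu1 nue nue' l0 ee' rho2 eq_v.
have opp_rho : rho' != - rho.
  apply: contra_neq ee' => rhoN.
  have lw : l *: (e + e') = rho *: perp nu (e + e').
    rewrite perpD; apply/rowP=> j; move/rowP/(_ j): eq_v.
    rewrite rhoN; move: (perp nu e) (perp nu e') => f f'.
    rewrite !mxE; lra.
  apply/eqP; rewrite -dot_eq0; move/(congr1 (dot (e + e'))): lw.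
  rewrite !dotZr (dotC _ (perp _ _)) dot_perp_id mulr0 => /eqP.
  by rewrite mulf_eq0 gt_eqF.
have rhoE : rho' = rho.
  move/eqP: rho2; rewrite eq_sym eqf_sqr (negbTE opp_rho) orbF.
  by move/eqP.
split=> //.
  by apply: contra_neq opp_rho => r0; rewrite rhoE r0 oppr0.
have : perp nu (rho *: perp nu (e - e')) = perp nu (l *: (e + e')).
  congr perp; rewrite perpD perpN; apply/rowP=> j; move/rowP/(_ j): eq_v.
  rewrite rhoE; move: (perp nu e) (perp nu e') => f f'; rewrite !mxE; lra.
rewrite !perpZ perpK // ?dot_lin ?nue ?nue' ?oppr0 ?addr0 // perpD => <-.
by rewrite scalerN opprK.
Qed.

End Tangents.

(** * Polygons with an incircle and their duals *)

Section TangentialPolygon.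
Variables (R : realType) (n : nat) (nu : 'rV[R]_3).
Notation vec := 'rV[R]_3.

(** P is circumscribed about the circle with center z and signed radius rho,
    in terms of unit edge directions e and tangent lengths l.  The touching
    point of the edge k is z - rho *: perp nu (e k).  The last field is the
    quarter turn of the equation between the two expressions for a vertex that
    [tan_start] and [tan_end] give. *)
Record tangential (P : 'I_n -> vec) (e : 'I_n -> vec) (l : 'I_n -> R)
    (z : vec) (rho : R) : Prop := Tangential {
  tan_nu : dot nu nu = 1;
  tan_normal : forall k, dot nu (e k) = 0;
  tan_unit : forall k, dot (e k) (e k) = 1;
  tan_pos : forall k, 0 < l k;
  tan_rho : rho != 0;
  tan_start : forall k, P k = z - rho *: perp nu (e k) - l k *: e k;
  tan_end : forall k, P (ordS k) = z - rho *: perp nu (e k) + l (ordS k) *: e k;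
  tan_step : forall k, rho *: (e k - e (ordS k)) =
    - (l (ordS k) *: (perp nu (e k) + perp nu (e (ordS k)))) }.

Lemma tangential_of_touches (P : 'I_n -> vec) :
  let l k := tangent_length (P k) in
  let e k := edge_dir (P k) (P (ordS k)) in
  'I_n -> unit_normal nu P ->
  (forall k, exists q, touches (P k) (P (ordS k)) q) ->
  (forall k, e k + e (ordS k) != 0) ->
  exists z rho, tangential P e l z rho.
Proof.
move=> l e i0 [nu1 nuP] Ptouch turn.
(* The touching point of an edge is unique, hence given by a formula. *)
pose q k := P k + l k *: e k.
have Pq k : touches (P k) (P (ordS k)) (q k).
  have [q0 Pq0] := Ptouch k; have [_ _ _ PkE _] := touches_frame Pq0.
  by have -> : q k = q0 by rewrite /q [X in X + _]PkE subrK.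
have nue k : dot nu (e k) = 0 by rewrite dotZr nuP mulr0.
have e1 k : dot (e k) (e k) = 1 by case/touches_frame: (Pq k).
have l0 k : 0 < l k by case/touches_frame: (Pq k).
have Pk k : P k = q k - l k *: e k by case/touches_frame: (Pq k).
have PSk k : P (ordS k) = q k + l (ordS k) *: e k.
  by case/touches_frame: (Pq k).
have q1 k : dot (q k) (q k) = 1 by case: (Pq k).
have qe k : dot (q k) (e k) = 0.
  by case: (Pq k) => _ _ _ qd; rewrite dotZr qd mulr0.
pose h := dot nu (P i0); pose z := h *: nu.
clearbody q e l.
have nuq k : dot nu (q k) = h.
  have /eqP := nuP k i0; rewrite !dot_lin -/h subr_eq0 => /eqP <-.
  by rewrite Pk !dot_lin nue mulr0 subr0.
(* The sign makes r positive when nu orients the polygon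
   counterclockwise. *)
pose r k := - dot (q k - z) (perp nu (e k)).
have qE k : q k = z - r k *: perp nu (e k).
  have : q k - z = dot (q k - z) (perp nu (e k)) *: perp nu (e k).
    apply: orthogonal_in_plane => //.
      by rewrite /z !dot_lin nu1 nuq mulr1 subrr.
    by rewrite /z !dot_lin nue qe mulr0 subrr.
  by move/eqP; rewrite subr_eq addrC => /eqP {1}->; rewrite /r scaleNr opprK.
have r2 k : r k ^+ 2 = 1 - h ^+ 2.
  rewrite sqrrN dot_perp_sqr //; last 2 first.
  - by rewrite /z !dot_lin nu1 nuq mulr1 subrr.
  - by rewrite /z !dot_lin nue qe mulr0 subrr.
  by rewrite /z !dot_lin (dotC _ nu) nuq nu1 e1 q1; ring.
have step k := @incircle_step _ (r k) (r (ordS k)) (l (ordS k)) nu (e k)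
  (e (ordS k)) nu1 (nue k) (nue _) (l0 _) (turn k).
have {}step k : [/\ r (ordS k) = r k, r k != 0 &
    r k *: (e k - e (ordS k)) =
    - (l (ordS k) *: (perp nu (e k) + perp nu (e (ordS k))))].
  apply: step; first by rewrite !r2.
  have := PSk k; rewrite Pk !qE -!addrA => /addrI.
  by move=> eq_v; rewrite addrC -eq_v addrC.
have rE k : r k = r i0 by apply: ordS_constant => j; case: (step j).
have r0 : r i0 != 0 by case: (step i0).
exists z, (r i0); split=> // k.
- by rewrite {1}Pk qE rE.
- by rewrite {1}PSk qE rE.
- by rewrite -(rE k); case: (step k).
Qed.

Section Dual.
Variables (P e : 'I_n -> vec) (l : 'I_n -> R) (z : vec) (rho : R).
Hypothesis tanP : tangential P e l z rho.

Let nu1 := tan_nu tanP.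
Let nue := tan_normal tanP.
Let e1 := tan_unit tanP.
Let edgeE k : P (ordS k) - P k = (l k + l (ordS k)) *: e k.
Proof.
rewrite (tan_end tanP) (tan_start tanP k) addrC opprB addrA subrK.
by rewrite -scalerDl.
Qed.

(** Every edge line of P has distance rho from z. *)
Let det_start k (x : R) : det3 (P k - z) (x *: e k) nu = rho * x.
Proof.
rewrite det3E (tan_start tanP) addrC addrA addKr.
by rewrite !(perpD, perpN, perpZ) perpK // !dot_lin dot_perp_id e1; ring.
Qed.

Lemma area_tangential : area nu P = rho * \sum_k l k.
Proof.
rewrite -mixed_area_diag (mixed_areaE z); last first.
  by move=> k; rewrite edgeE det3E perpZ !dot_lin dot_perp_id !mulr0.
transitivity (2^-1 * (\sum_k rho * l k + \sum_k rho * l (ordS k))).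
  rewrite -big_split /=; congr (_ * _); apply: eq_bigr => k _.
  by rewrite edgeE det_start mulrDr.
by rewrite -!mulr_sumr sum_ordS; field.
Qed.

Variables (m : 'I_n -> vec) (delta : 'I_n -> R).
Hypothesis deltaS : forall k, delta (ordS k) = - delta k.
Hypothesis m_edge : forall k,
  m (ordS k) - m k = (delta k * ((l k)^-1 + (l (ordS k))^-1)) *: e k.

(** Seen from z, all support numbers of P are equal, so that the mixed area is
    rho / 2 times the sum of the signed edge lengths of m.  At each vertex k
    the two adjacent edges contribute opposite multiples of 1 / l k. *)
Lemma mixed_area_dual : mixed_area nu m P = 0.
Proof.
transitivity (mixed_area nu P m).
  rewrite /mixed_area (@eq_area _ _ _ _ (fun k => P k + m k)); first by ring.
  by move=> k; rewrite addrC.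
rewrite (mixed_areaE z); last first.
  by move=> k; rewrite edgeE m_edge det3E perpZ !dot_lin dot_perp_id !mulr0.
transitivity (2^-1 * (\sum_k rho * (delta k / l k)
                      - \sum_k rho * (delta (ordS k) / l (ordS k)))).
  rewrite -sumrB; congr (_ * _); apply: eq_bigr => k _.
  by rewrite m_edge det_start deltaS; ring.
by rewrite (sum_ordS (fun k => rho * (delta k / l k))) subrr mulr0.
Qed.

(** The vectors O k of the proof are all equal, and seen from this point the
    support number of the edge k of m is - delta k / rho, while the length of
    this edge is delta k * (1 / l k + 1 / l (ordS k)).  In their product the
    alternating sign is squared, so no cancellation occurs. *)
Lemma area_dual : area nu m = - (rho^-1 * \sum_k delta k ^+ 2 / l k).
Proof.
pose O k : vec := m k + delta k *: ((l k)^-1 *: e k - rho^-1 *: perp nu (e k)).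
have rho0 := tan_rho tanP.
have l0 k : l k != 0 by rewrite gt_eqF ?(tan_pos tanP).
have OS k : O (ordS k) = O k.
  have := tan_step tanP k; have := m_edge k; rewrite /O deltaS.
  move: (perp nu _) (perp nu _) => f f' dm st.
  apply/rowP=> j; move/rowP/(_ j): dm; move/rowP/(_ j): st.
  have := l0 k; have := l0 (ordS k); rewrite !mxE.
  move: (l k) (l (ordS k)) (m _ 0 j) (m _ 0 j) (e _ 0 j) (e _ 0 j) (f 0 j) (f' 0 j).
  move=> l1 l2 m1 m2 e2 e3 f1 f2 l20 l10 st dm.
  have -> : m2 = m1 + delta k * (l1^-1 + l2^-1) * e3 by rewrite -dm; ring.
  have -> : e3 = e2 - l2 * (f2 + f1) / rho.
    apply: (mulfI rho0); transitivity (rho * (e3 - e2) + rho * e2); first ring.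
    by rewrite st; field.
  by field; rewrite l10 l20 rho0.
have dmE k : det3 (m k - O k) (m (ordS k) - m k) nu =
   - (rho^-1 * (delta k ^+ 2 * ((l k)^-1 + (l (ordS k))^-1))).
  rewrite m_edge det3E /O opprD addNKr.
  rewrite !(perpD, perpN, perpZ) perpK // !dot_lin dot_perp_id e1.
  by field; rewrite !l0 rho0.
case: (pickP (@predT 'I_n)) => [i0 _ | n0]; last first.
  by rewrite /area !big_pred0 // !mulr0 oppr0.
rewrite -mixed_area_diag (mixed_areaE (O i0)); last first.
  by move=> k; rewrite m_edge det3E perpZ !dot_lin dot_perp_id !mulr0.
transitivity (2^-1 * (\sum_k - (rho^-1 * (delta k ^+ 2 / l k)) +
   \sum_k - (rho^-1 * (delta (ordS k) ^+ 2 / l (ordS k))))).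
  rewrite -big_split /=; congr (_ * _); apply: eq_bigr => k _.
  by rewrite (ordS_constant OS i0 k) dmE deltaS sqrrN; ring.
rewrite (sum_ordS (fun k => - (rho^-1 * (delta k ^+ 2 / l k)))).
by rewrite sumrN -mulr_sumr; field.
Qed.

Hypothesis i0 : 'I_n.
Hypothesis delta_neq0 : forall k, delta k != 0.

Lemma area_dual_neq0 : area nu m != 0.
Proof.
rewrite area_dual oppr_eq0 mulf_neq0 ?invr_eq0 ?(tan_rho tanP) //.
have pos k : 0 < delta k ^+ 2 / l k.
  by rewrite divr_gt0 ?(tan_pos tanP) // lt0r sqr_ge0 sqrf_eq0 delta_neq0.
rewrite (bigD1 i0) //= gt_eqF // ltr_wpDr //.
by apply: sumr_ge0 => k _; apply: ltW.
Qed.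

Lemma area_ratio_le0 : area nu P / area nu m <= 0.
Proof.
rewrite area_tangential area_dual invrN mulrN oppr_le0 invfM invrK.
set S1 := \sum_k l k; set S2 := \sum_k _.
have -> : rho * S1 * (rho * S2^-1) = rho ^+ 2 * (S1 / S2) by ring.
rewrite mulr_ge0 ?sqr_ge0 // divr_ge0 // sumr_ge0 // => k _.
  exact: ltW (tan_pos tanP k).
by rewrite divr_ge0 ?sqr_ge0 // ltW // (tan_pos tanP).
Qed.

End Dual.
End TangentialPolygon.

(** * Faces of the Koebe polyhedron and of its cover *)

Lemma ordS2_neq n (i : 'I_n) : (3 <= n)%N ->
  ordS (ordS i) <> i /\ ordS (ordS i) <> ordS i.
Proof.
move=> n3; have ordS_neq (d : nat) : (0 < d < 3)%N -> ((i + d) %% n)%N <> i.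
  case/andP=> d0 d3 /eqP; rewrite -{2}(modn_small (ltn_ord i)) -{2}(addn0 i).
  by rewrite eqn_modDl mod0n modn_small ?(leq_trans d3) // gtn_eqF.
split=> [/(congr1 val)|/ordS_inj /(congr1 val)] /=.
  by rewrite -addn1 modnDml addn1 -addn2; apply: ordS_neq.
by rewrite -addn1; apply: ordS_neq.
Qed.

(** Opposite consecutive directions would make three consecutive vertices
    collinear. *)
Lemma strictly_convex_turn (R : realType) n (P : 'I_n -> 'rV[R]_3) i :
  (3 <= n)%N -> strictly_convex P ->
  (exists q, touches (P (ordS i)) (P (ordS (ordS i))) q) ->
  edge_dir (P i) (P (ordS i)) + edge_dir (P (ordS i)) (P (ordS (ordS i))) != 0.
Proof.
move=> n3 [nu [_ convP]] [q /touches_frame[lb0 lc0 _ _ _]].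
have [i2i i2Si] := ordS2_neq i n3; move: (convP i _ i2i i2Si).
apply: contraTneq; rewrite /edge_dir.
move: (P i) (P (ordS i)) (P (ordS (ordS i))) lb0 lc0 => a b c lb0 lc0.
set x := (_ + _)^-1; set y := (_ + _)^-1 => turn0.
have y0 : y != 0 by rewrite invr_eq0 gt_eqF // addr_gt0.
have -> : c - a = (1 - x / y) *: (b - a).
  apply: (scalerI y0); apply/rowP=> j; move/rowP/(_ j): turn0; rewrite !mxE.
  move: (a 0 j) (b 0 j) (c 0 j) => a' b' c' turn0.
  have -> : y * (c' - a') = y * (b' - a') - x * (b' - a').
    by apply/eqP; rewrite -subr_eq0 -turn0; apply/eqP; ring.
  by field.
by rewrite det3E dotZr dot_perp_id mulr0 ltxx.
Qed.

Section KoebeCover.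
Variables (R : realType) (C C' : complex) (p : even_cover C' C).
Variable s : mesh R C.
Hypothesis s_koebe : koebe s.

Lemma koebe_pullback_touches x y : edge x y ->
  exists q, touches (pullback p s x) (pullback p s y) q.
Proof. by case: s_koebe => _ _ tch /(cover_edge p) /tch. Qed.

Lemma koebe_pullback_planar : polyhedral (pullback p s).
Proof.
case: s_koebe => planar_s _ _ f; have [nu [nu1 nus]] := planar_s (cface p f).
exists nu; split=> // k l; rewrite /polygon /pullback !cover_bd.
exact: nus.
Qed.

(** Only consecutive vertices matter for the existence of the incircle with a
    constant signed radius, so that a polygon that runs twice around an odd
    face inherits it. *)
Lemma koebe_pullback_tangential (f : face C') nu :
  let P := polygon (pullback p s) f in
  unit_normal nu P ->
  exists z rho, tangential nu P (fun k => edge_dir (P k) (P (ordS k)))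
    (fun k => tangent_length (P k)) z rho.
Proof.
move=> P nuP; have n0 : (0 < deg f)%N by apply: leq_trans (deg_ge3 f).
have Ptouch k : exists q, touches (P k) (P (ordS k)) q.
  exact: koebe_pullback_touches (bd_edge k).
apply: tangential_of_touches => //; first exact: Ordinal n0.
have PE k : P k = polygon s (cface p f) (cwrap p k).
  by rewrite /P /polygon /pullback cover_bd.
move=> k; have := Ptouch (ordS k); rewrite !PE !cover_wrap.
by apply: strictly_convex_turn (deg_ge3 _) _; case: s_koebe.
Qed.
End KoebeCover.

Theorem theorem20 (R : realType) (C C' : complex) (p : even_cover C' C)
    (s : mesh R C) (m : mesh R C')
    (s_koebe : koebe s) (m_dual : christoffel_dual (pullback p s) m) :
  [/\ polyhedral m,
      parallel m (pullback p s) &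
      forall (f : face C') (nu : 'rV[R]_3),
        unit_normal nu (polygon (pullback p s) f) ->
        [/\ unit_normal nu (polygon m f),
            area nu (polygon m f) != 0,
            mean_curvature m (pullback p s) f nu = 0 &
            exists k1 k2 : R,
              principal_curvatures m (pullback p s) f nu k1 k2 /\ k2 = - k1]].
Proof.
case: m_dual => c [eps [c0 eps_sign eps_alt m_edge]].
set S := pullback p s in m_edge *.
have dual_edge x y : edge x y -> m y - m x =
    (c * eps x y * ((tangent_length (S x))^-1 + (tangent_length (S y))^-1))
      *: edge_dir (S x) (S y).
  move=> xy; have [q Sq] := koebe_pullback_touches p s_koebe xy.
  by rewrite (m_edge _ _ q) // (inversion_edge Sq) scalerA.
have normal_m (f : face C') nu :
    unit_normal nu (polygon S f) -> unit_normal nu (polygon m f).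
  case=> nu1 nuS; split=> // k l; rewrite dotDr dotNr; apply/eqP.
  rewrite subr_eq0; apply/eqP; move: k l.
  apply: (ordS_constant (f := fun k => dot nu (polygon m f k))) => k.
  apply/eqP; rewrite -subr_eq0 -dotNr -dotDr dual_edge; last exact: bd_edge.
  by rewrite !dotZr (nuS (ordS k) k) !mulr0.
split.
- move=> f; have [nu nuS] := koebe_pullback_planar p s_koebe f.
  by exists nu; apply: normal_m.
- move=> x y /dual_edge ->; rewrite scalerA.
  by eexists 1, _; rewrite oner_neq0 scale1r.
move=> f nu nuS; have [z [rho tanS]] := koebe_pullback_tangential s_koebe nuS.
pose delta k := c * eps (@bd C' f k) (bd (ordS k)).
have deltaS k : delta (ordS k) = - delta k by rewrite /delta eps_alt mulrN.
have delta0 k : delta k != 0.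
  rewrite mulf_neq0 //; have [_ [] ->] := eps_sign _ _ (bd_edge k).
    exact: oner_neq0.
  by rewrite oppr_eq0 oner_neq0.
have mS k := dual_edge _ _ (bd_edge (c := C') (f := f) k).
have deg_gt0 : (0 < deg f)%N by apply: leq_trans (deg_ge3 f).
pose i0 := Ordinal deg_gt0.
have H0 : mean_curvature m S f nu = 0.
  by rewrite /mean_curvature (mixed_area_dual tanS deltaS mS) oppr0 mul0r.
split=> //; first exact: normal_m.
  exact: (area_dual_neq0 tanS (m := polygon m f) deltaS mS i0 delta0).
exists (Num.sqrt (- gauss_curvature m S f nu)).
exists (- Num.sqrt (- gauss_curvature m S f nu)); split=> //.
rewrite /principal_curvatures H0 mulr0 scale0r subr0 polyCN opprK -subr_sqr.
rewrite -polyC_exp sqr_sqrtr; first by rewrite polyCN opprK.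
rewrite oppr_ge0.
exact: (area_ratio_le0 tanS (m := polygon m f) deltaS mS).
Qed.
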